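(* The Hopf algebra $\mathcal{A}_1$ is not quasitriangular.
   Context: $\Bbbk$ is an algebraically closed field of characteristic zero. $\mathcal{A}_1$ is the 72-dimensional Hopf algebra generated as an algebra by $H_t$ ($t\in\mathbb{S}_3$) and $a_{12},a_{13},a_{23}$ (indexed by the transpositions of $\mathbb{S}_3$; $H_{12}=H_{(12)}$, etc.), with relations $H_e=1$, $H_tH_s=H_{ts}$; $H_ta_i=\operatorname{sgn}(t)a_{tit^{-1}}H_t$; $a_{12}^2=0$; $a_{12}a_{23}+a_{23}a_{13}+a_{13}a_{12}=1-H_{12}H_{23}$; comultiplication $\Delta(H_t)=H_t\otimes H_t$, $\Delta(a_i)=H_i\otimes a_i+a_i\otimes1$. *)

(* Defs.v *)
From HB Require Import structures.
From mathcomp Require Import all_boot all_order all_algebra all_fingroup.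
From mathcomp Require Import sesquilinear.
From mathcomp Require Import boolp classical_sets.
From mathcomp Require Import generic_quotient.

Set Implicit Arguments.
Unset Strict Implicit.
Unset Printing Implicit Defensive.

Import GRing.Theory.
Local Open Scope ring_scope.
Local Open Scope quotient_scope.

Notation bilin f := (bilinear_for *:%R *:%R f).

(* [tensor U V] is made of the finite formal sums of pairs [(u, v)], encoded as
   lists, modulo the least congruence that makes concatenation commutative and
   [(u, v)] bilinear. *)

Section Tensor.
Variables (k : fieldType) (U V : lmodType k).

Inductive tens_eq : seq (U * V) -> seq (U * V) -> Prop :=
| Teq_refl s : tens_eq s s
| Teq_sym s t : tens_eq s t -> tens_eq t s
| Teq_trans s t r : tens_eq s t -> tens_eq t r -> tens_eq s r
| Teq_cat s s' t t' : tens_eq s s' -> tens_eq t t' ->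
    tens_eq (s ++ t) (s' ++ t')
| Teq_catC s t : tens_eq (s ++ t) (t ++ s)
| Teq_Dl u u' v : tens_eq [:: (u + u', v)] [:: (u, v); (u', v)]
| Teq_Dr u v v' : tens_eq [:: (u, v + v')] [:: (u, v); (u, v')]
| Teq_Z a u v : tens_eq [:: (a *: u, v)] [:: (u, a *: v)]
| Teq_0 v : tens_eq [:: (0, v)] [::].

Definition tens_rel s t := `[< tens_eq s t >].
Fact te_refl : reflexive tens_rel.
Proof. by move=> s; apply/asboolP; apply: Teq_refl. Qed.
Fact te_sym : symmetric tens_rel.
Proof. by move=> s t; apply/asboolP/asboolP; apply: Teq_sym. Qed.
Fact te_trans : transitive tens_rel.
Proof.
by move=> t s r /asboolP st /asboolP tr; apply/asboolP; apply: Teq_trans tr.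
Qed.
Canonical tens_equiv := EquivRel tens_rel te_refl te_sym te_trans.

Definition tensor : Type := {eq_quot tens_rel}.
HB.instance Definition _ := Choice.copy tensor {eq_quot tens_rel}.

Definition tens_class (s : seq (U * V)) : tensor := \pi_({eq_quot tens_rel}) s.
Definition tens_repr (x : tensor) : seq (U * V) := repr (x : {eq_quot tens_rel}).

Lemma tens_reprK x : tens_class (tens_repr x) = x. Proof. exact: reprK. Qed.
Lemma tens_classP s t : tens_eq s t -> tens_class s = tens_class t.
Proof. move=> st; apply: (elimT (@eqmodP _ tens_equiv s t)).
exact/asboolP. Qed.
Lemma tens_repr_class s : tens_eq (tens_repr (tens_class s)) s.
Proof. apply/asboolP.
apply: (introT (@eqmodP _ tens_equiv _ s)).
exact: reprK. Qed.

Definition pure (u : U) (v : V) : tensor := tens_class [:: (u, v)].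
Definition tens_zero : tensor := tens_class [::].
Definition tens_add (x y : tensor) : tensor := tens_class (tens_repr x ++ tens_repr y).
Definition tens_scale (a : k) (x : tensor) : tensor :=
  tens_class [seq (a *: p.1, p.2) | p <- tens_repr x].
Definition tens_opp (x : tensor) : tensor := tens_scale (-1) x.

Lemma tens_add_class s t : tens_add (tens_class s) (tens_class t) = tens_class (s ++ t).
Proof. by apply: tens_classP; apply: Teq_cat; apply: tens_repr_class. Qed.

Lemma tens_class_cons p s : tens_class (p :: s) = tens_add (tens_class [:: p]) (tens_class s).
Proof. by rewrite tens_add_class. Qed.

Lemma tens_eq_scale a s t : tens_eq s t ->
  tens_eq [seq (a *: p.1, p.2) | p <- s] [seq (a *: p.1, p.2) | p <- t].
Proof.
elim=> {s t} /=.
- by move=> s; apply: Teq_refl.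
- by move=> s t _; apply: Teq_sym.
- by move=> s t r _ IH1 _; apply: Teq_trans.
- by move=> s s' t t' _ IH1 _ IH2; rewrite !map_cat; apply: Teq_cat.
- by move=> s t; rewrite !map_cat; apply: Teq_catC.
- by move=> u u' v; rewrite scalerDr; apply: Teq_Dl.
- by move=> u v v'; apply: Teq_Dr.
- by move=> b u v; rewrite !scalerA mulrC -scalerA; apply: Teq_Z.
- by move=> v; rewrite scaler0; apply: Teq_0.
Qed.

Lemma tens_scale_class a s :
  tens_scale a (tens_class s) = tens_class [seq (a *: p.1, p.2) | p <- s].
Proof. by apply: tens_classP; apply: tens_eq_scale; apply: tens_repr_class. Qed.

Fact tens_addA : associative tens_add.
Proof.
move=> x y z; rewrite -(tens_reprK x) -(tens_reprK y) -(tens_reprK z).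
by rewrite !tens_add_class catA.
Qed.
Fact tens_addC : commutative tens_add.
Proof. by move=> x y; apply: tens_classP; apply: Teq_catC. Qed.
Fact tens_add0 : left_id tens_zero tens_add.
Proof. by move=> x; rewrite -(tens_reprK x) tens_add_class. Qed.

Fact tens_scaleA a b x : tens_scale a (tens_scale b x) = tens_scale (a * b) x.
Proof.
rewrite -(tens_reprK x) !tens_scale_class -map_comp; congr tens_class.
by apply: eq_map => p /=; rewrite scalerA.
Qed.
Fact tens_scale1 : left_id 1 tens_scale.
Proof.
move=> x; rewrite -(tens_reprK x) tens_scale_class; congr tens_class.
by rewrite -[RHS]map_id; apply: eq_map => -[u v] /=; rewrite scale1r.
Qed.
Fact tens_scaleDr : right_distributive tens_scale tens_add.
Proof.
move=> a x y; rewrite -(tens_reprK x) -(tens_reprK y).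
by rewrite tens_add_class !tens_scale_class tens_add_class map_cat.
Qed.
Fact tens_scaleDl x :
  {morph tens_scale^~ x : a b / a + b >-> tens_add a b}.
Proof.
move=> a b; rewrite -(tens_reprK x) !tens_scale_class.
elim: (tens_repr x) => [|[u v] s IH] /=; first by rewrite tens_add_class.
rewrite !(tens_class_cons _ (map _ _)) IH scalerDl (tens_classP (Teq_Dl _ _ _)).
rewrite (tens_class_cons _ [:: _]) -!tens_addA; congr tens_add.
rewrite !tens_addA; congr tens_add.
exact: tens_addC.
Qed.
Fact tens_addN : left_inverse tens_zero tens_opp tens_add.
Proof.
move=> x; rewrite -[X in tens_add _ X]tens_scale1 -tens_scaleDl addNr.
rewrite -(tens_reprK x) tens_scale_class; elim: (tens_repr x) => [|[u v] s IH] //=.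
by rewrite scale0r -cat1s -tens_add_class IH (tens_classP (Teq_0 _)) tens_add0.
Qed.

HB.instance Definition _ :=
  GRing.isZmodule.Build tensor tens_addA tens_addC tens_add0 tens_addN.
HB.instance Definition _ := GRing.Zmodule_isLmodule.Build k tensor
  tens_scaleA tens_scale1 tens_scaleDr tens_scaleDl.

(* Defined for every [f], on a chosen representative of the class [x]; it is
   independent of this choice when [f] is bilinear, see [tlift_pure]. *)
Definition tlift (W : lmodType k) (f : U -> V -> W) (x : tensor) : W :=
  \sum_(p <- tens_repr x) f p.1 p.2.

Lemma tens_sum (x : tensor) : exists s, x = \sum_(p <- s) pure p.1 p.2.
Proof.
exists (tens_repr x); rewrite -[LHS]tens_reprK; elim: (tens_repr x) => [|[u v] s IH].
  by rewrite big_nil.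
by rewrite big_cons -IH -cat1s -tens_add_class.
Qed.

Lemma tens_ind (P : tensor -> Prop) :
  P 0 -> (forall u v, P (pure u v)) -> (forall x y, P x -> P y -> P (x + y)) ->
  forall x, P x.
Proof.
by move=> P0 Pp PD x; have [s ->] := tens_sum x; elim/big_rec: _ => // p y _; apply: PD.
Qed.

Lemma pureP : bilin pure.
Proof.
have Dl u u' v : pure (u + u') v = pure u v + pure u' v.
  by rewrite /pure (tens_classP (Teq_Dl _ _ _)); apply: tens_class_cons.
have Dr u v v' : pure u (v + v') = pure u v + pure u v'.
  by rewrite /pure (tens_classP (Teq_Dr _ _ _)); apply: tens_class_cons.
have Zl a u v : pure (a *: u) v = a *: pure u v by rewrite [RHS]tens_scale_class.
have Zr a u v : pure u (a *: v) = a *: pure u v.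
  by rewrite -Zl; apply: esym; apply: tens_classP; apply: Teq_Z.
by split=> [v a u u'|u a v v'] /=; rewrite ?Dl ?Dr ?Zl ?Zr.
Qed.

Section Lift.
Variables (W : lmodType k) (f : U -> V -> W) (fP : bilin f).

Lemma tens_eq_sum s t : tens_eq s t ->
  \sum_(p <- s) f p.1 p.2 = \sum_(p <- t) f p.1 p.2.
Proof.
have fDl v u u' : f (u + u') v = f u v + f u' v.
  by have := fP.1 v 1 u u'; rewrite /= !scale1r.
have fDr u v v' : f u (v + v') = f u v + f u v'.
  by have := fP.2 u 1 v v'; rewrite /= !scale1r.
have f0l v : f 0 v = 0 by apply: (addrI (f 0 v)); rewrite -fDl !addr0.
have f0r u : f u 0 = 0 by apply: (addrI (f u 0)); rewrite -fDr !addr0.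
elim=> {s t} //.
- by move=> s t r _ -> _ ->.
- by move=> s s' t t' _ e1 _ e2; rewrite !big_cat e1 e2.
- by move=> s t; rewrite !big_cat /= addrC.
- by move=> u u' v; rewrite !big_cons !big_nil !addr0 /= fDl.
- by move=> u v v'; rewrite !big_cons !big_nil !addr0 /= fDr.
- move=> a u v; rewrite !big_cons !big_nil !addr0 /=.
  have := fP.1 v a u 0; rewrite /= f0l !addr0 => ->.
  by have := fP.2 u a v 0; rewrite /= f0r !addr0 => ->.
- by move=> v; rewrite big_cons !big_nil /= f0l addr0.
Qed.

Lemma tlift_class s : tlift f (tens_class s) = \sum_(p <- s) f p.1 p.2.
Proof. exact: tens_eq_sum (tens_repr_class s). Qed.

Lemma tlift_pure u v : tlift f (pure u v) = f u v.
Proof. by rewrite tlift_class big_cons big_nil addr0. Qed.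

Lemma tlift_linear : linear (tlift f).
Proof.
move=> a x y; rewrite -(tens_reprK x) -(tens_reprK y).
rewrite [a *: _]tens_scale_class [_ + _ in LHS]tens_add_class !tlift_class big_cat big_map /=.
congr (_ + _); rewrite scaler_sumr; apply: eq_bigr => p _ /=.
have f0l v : f 0 v = 0.
  have := fP.1 v (-1) 0 0; rewrite /= scaleN1r addNr => ->.
  by rewrite scaleN1r addNr.
by have := fP.1 p.2 a p.1 0; rewrite /= f0l !addr0.
Qed.

Lemma tlift_uniq (h : {linear tensor -> W}) :
  (forall u v, h (pure u v) = f u v) -> h =1 tlift f.
Proof.
move=> hf x; have [s ->] := tens_sum x.
pose HL := GRing.isLinear.Build k _ _ _ (tlift f) tlift_linear.
pose L : {linear tensor -> W} := HB.pack (tlift f) HL.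
rewrite -[tlift f]/(L : _ -> _) !linear_sum; apply: eq_bigr => p _.
by rewrite hf /L /= tlift_pure.
Qed.

End Lift.

Lemma tlift_funD (W : lmodType k) (a : k) (f g : U -> V -> W) x :
  tlift (fun u v => a *: f u v + g u v) x = a *: tlift f x + tlift g x.
Proof. by rewrite /tlift scaler_sumr -big_split. Qed.

Lemma eq_tlift (W : lmodType k) (f g : U -> V -> W) x :
  (forall u v, f u v = g u v) -> tlift f x = tlift g x.
Proof. by move=> fg; apply: eq_bigr => p _; apply: fg. Qed.

End Tensor.

Arguments pure {k U V}.
Arguments tensor {k} (U V)%_type_scope.

Notation "U ⊗ V" := (tensor U V)
  (at level 40, left associativity) : type_scope.
Notation "u ⊗ v" := (pure u v) (at level 40, left associativity) : ring_scope.

Lemma linear_functional (k : fieldType) (V : lmodType k) (v : V) :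
  v != 0 -> exists f : {linear V -> k^o}, f v = 1.
Proof.
move=> v0.
pose P (S : set V) := (forall a x y, S x -> S y -> S (a *: x + y)) /\ ~ S v.
have [M [[Mlin Mv] Mmax]] : exists A, P A /\ forall B, (A `<` B)%classic -> ~ P B.
  apply: Zorn_bigcup => F FP Ftot; split; last by case=> S FS; case: (FP S FS).
  move=> a x y [S FS Sx] [T FT Ty].
  case: (Ftot S T FS FT) => [ST|TS].
    by exists T => //; apply: (FP T FT).1 => //; apply: ST.
  by exists S => //; apply: (FP S FS).1 => //; apply: TS.
have M0 : M 0.
  have [[x Mx]|Mempty] := EM (exists x, M x).
    by have := Mlin (-1) x x Mx Mx; rewrite scaleN1r addNr.
  exfalso; apply: (Mmax [set 0]%classic); last first.
    split=> [a x y -> ->|/= ve]; first by rewrite /= scaler0 addr0.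
    by move: v0; rewrite ve eqxx.
  split; first by move=> x Mx; case: Mempty; exists x.
  by move=> sub; apply: Mempty; exists 0; apply: sub.
have MZ a x : M x -> M (a *: x).
  by move=> Mx; rewrite -[_ *: _]addr0; apply: Mlin.
have MB x y : M x -> M y -> M (x - y).
  by move=> Mx My; rewrite addrC -scaleN1r; apply: Mlin.
have ex x : exists c, M (x - c *: v).
  have [Mx|nMx] := EM (M x); first by exists 0; rewrite scale0r subr0.
  pose S := [set y | exists2 a, True & M (y - a *: x)]%classic.
  have MS : (M `<` S)%classic.
    split.
      by move=> y My; exists 0 => //; rewrite scale0r subr0.
    by move=> sub; apply/nMx/sub; exists 1 => //; rewrite scale1r subrr.
  have [Sv|nSv] := EM (S v); last first.
    case: (Mmax S MS); split=> // a y z [b _ yb] [c _ zc].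
    exists (a * b + c) => //.
    have := Mlin a _ _ yb zc.
    by rewrite scalerBr scalerDl scalerA opprD addrACA.
  case: Sv => a _ Ma.
  have a0 : a != 0.
    by apply/eqP => a0; move: Ma; rewrite a0 scale0r subr0.
  exists a^-1; have := MZ (- a^-1) _ Ma.
  by rewrite scalerBr !scaleNr opprK scalerA mulVf // scale1r addrC.
have uniq c d x : M (x - c *: v) -> M (x - d *: v) -> c = d.
  move=> cM dM; apply/eqP; rewrite -subr_eq0; apply/negP => /negP cd.
  have := MB _ _ dM cM.
  rewrite opprB addrC addrA subrK -scalerBl => /(MZ (c - d)^-1).
  by rewrite scalerA mulVf // scale1r.
have [f fP] := choice ex.
have flin : linear (f : V -> k^o).
  move=> a x y; apply: (uniq _ _ (a *: x + y)); first exact: fP.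
  have := Mlin a _ _ (fP x) (fP y).
  by rewrite scalerBr scalerA scalerDl opprD addrACA.
pose L : {linear V -> k^o} :=
  HB.pack (f : V -> k^o) (GRing.isLinear.Build k V k^o *:%R f flin).
exists L; apply: (uniq _ _ v); first exact: fP.
by rewrite scale1r subrr.
Qed.

Section TensorAlgebra.
Variables (k : fieldType) (A B : algType k).

Lemma pureDl (U V : lmodType k) (u u' : U) (v : V) :
  (u + u') ⊗ v = u ⊗ v + u' ⊗ v.
Proof. by have := (pureP U V).1 v 1 u u'; rewrite /= !scale1r. Qed.
Lemma pureDr (U V : lmodType k) (u : U) (v v' : V) :
  u ⊗ (v + v') = u ⊗ v + u ⊗ v'.
Proof. by have := (pureP U V).2 u 1 v v'; rewrite /= !scale1r. Qed.
Lemma pure0l (U V : lmodType k) (v : V) : (0 : U) ⊗ v = 0.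
Proof. by apply: (addrI ((0 : U) ⊗ v)); rewrite -pureDl !addr0. Qed.
Lemma pure0r (U V : lmodType k) (u : U) : u ⊗ (0 : V) = 0.
Proof. by apply: (addrI (u ⊗ (0 : V))); rewrite -pureDr !addr0. Qed.
Lemma pureZl (U V : lmodType k) a (u : U) (v : V) : (a *: u) ⊗ v = a *: (u ⊗ v).
Proof. by have := (pureP U V).1 v a u 0; rewrite /= pure0l !addr0. Qed.
Lemma pureZr (U V : lmodType k) a (u : U) (v : V) : u ⊗ (a *: v) = a *: (u ⊗ v).
Proof. by have := (pureP U V).2 u a v 0; rewrite /= pure0r !addr0. Qed.

Definition tens_mul (x y : A ⊗ B) : A ⊗ B :=
  tlift (fun a b => tlift (fun a' b' => (a * a') ⊗ (b * b')) y) x.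

Lemma tens_mul_inner a b : bilin (fun (a' : A) (b' : B) => (a * a') ⊗ (b * b')).
Proof.
by split=> [? c ? ?|? c ? ?] /=;
   rewrite mulrDr -scalerAr ?pureDl ?pureDr ?pureZl ?pureZr.
Qed.

Lemma tens_mul_outer y :
  bilin (fun (a : A) (b : B) => tlift (fun a' b' => (a * a') ⊗ (b * b')) y).
Proof.
by split=> [? c ? ?|? c ? ?] /=; rewrite -tlift_funD; apply: eq_tlift => u v;
   rewrite mulrDl -scalerAl ?pureDl ?pureDr ?pureZl ?pureZr.
Qed.

Lemma tens_mul_linl y : linear (tens_mul^~ y).
Proof. exact: tlift_linear (tens_mul_outer y). Qed.
Lemma tens_mul_linr x : linear (tens_mul x).
Proof.
move=> c y z; rewrite /tens_mul -tlift_funD; apply: eq_tlift => u v.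
exact: tlift_linear (tens_mul_inner u v) _ _ _.
Qed.
Lemma tens_mul_pure a b a' b' : tens_mul (a ⊗ b) (a' ⊗ b') = (a * a') ⊗ (b * b').
Proof. by rewrite /tens_mul (tlift_pure (tens_mul_outer _)) (tlift_pure (tens_mul_inner _ _)). Qed.

Fact tens_mulDl : left_distributive tens_mul +%R.
Proof. by move=> x y z; have := tens_mul_linl z 1 x y; rewrite !scale1r. Qed.
Fact tens_mulDr : right_distributive tens_mul +%R.
Proof. by move=> x y z; have := tens_mul_linr x 1 y z; rewrite !scale1r. Qed.
Lemma tens_mul0l y : tens_mul 0 y = 0.
Proof. by apply: (addrI (tens_mul 0 y)); rewrite -tens_mulDl !addr0. Qed.
Lemma tens_mul0r y : tens_mul y 0 = 0.
Proof. by apply: (addrI (tens_mul y 0)); rewrite -tens_mulDr !addr0. Qed.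

Fact tens_mulA : associative tens_mul.
Proof.
move=> x y z; elim/tens_ind: x => [|a b|x x' IH IH']; first by rewrite !tens_mul0l.
  elim/tens_ind: y => [|a' b'|y y' IH IH']; first by rewrite !(tens_mul0l, tens_mul0r).
    elim/tens_ind: z => [|a'' b''|z z' IH IH']; first by rewrite !tens_mul0r.
      by rewrite !tens_mul_pure !mulrA.
    by rewrite !tens_mulDr IH IH'.
  by rewrite !(tens_mulDl, tens_mulDr) IH IH'.
by rewrite !tens_mulDl IH IH'.
Qed.
Fact tens_mul1 : left_id ((1 : A) ⊗ (1 : B)) tens_mul.
Proof.
move=> x; elim/tens_ind: x => [|a b|x y IH IH']; first by rewrite tens_mul0r.
  by rewrite tens_mul_pure !mul1r.
by rewrite tens_mulDr IH IH'.
Qed.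
Fact tens_mulr1 : right_id ((1 : A) ⊗ (1 : B)) tens_mul.
Proof.
move=> x; elim/tens_ind: x => [|a b|x y IH IH']; first by rewrite tens_mul0l.
  by rewrite tens_mul_pure !mulr1.
by rewrite tens_mulDl IH IH'.
Qed.
Fact tens_1neq0 : (1 : A) ⊗ (1 : B) != 0.
Proof.
have [f f1] := linear_functional (oner_neq0 A).
have [g g1] := linear_functional (oner_neq0 B).
have fgP : bilin (fun a b => (f a * g b : k^o)).
  split=> [b c x y|a c x y] /=; rewrite linearP.
    by rewrite mulrDl -scalerAl.
  by rewrite mulrDr -scalerAr.
apply/eqP => /(congr1 (tlift (fun a b => (f a * g b : k^o)))).
rewrite (tlift_pure fgP) f1 g1 mulr1.
have := tlift_linear fgP (-1) 0 0.
rewrite scaleN1r scaleN1r !addNr => -> /eqP.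
by rewrite oner_eq0.
Qed.

HB.instance Definition _ := GRing.Zmodule_isNzRing.Build (A ⊗ B)%type
  tens_mulA tens_mul1 tens_mulr1 tens_mulDl tens_mulDr tens_1neq0.

Fact tens_scaleAl c (x y : A ⊗ B) : c *: (x * y) = (c *: x) * y.
Proof.
by have := tens_mul_linl y c x 0; rewrite tens_mul0l !addr0.
Qed.
HB.instance Definition _ :=
  GRing.Lmodule_isLalgebra.Build k (A ⊗ B)%type tens_scaleAl.

Fact tens_scaleAr c (x y : A ⊗ B) : c *: (x * y) = x * (c *: y).
Proof.
by have := tens_mul_linr x c y 0; rewrite tens_mul0r !addr0.
Qed.
HB.instance Definition _ :=
  GRing.Lalgebra_isAlgebra.Build k (A ⊗ B)%type tens_scaleAr.

Lemma pureM (a a' : A) (b b' : B) :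
  (a ⊗ b) * (a' ⊗ b') = (a * a') ⊗ (b * b').
Proof. exact: tens_mul_pure. Qed.

Lemma pure1 : (1 : A) ⊗ (1 : B) = 1.
Proof. by []. Qed.

End TensorAlgebra.

Section TensorMaps.
Variable k : fieldType.

Definition tmap (U V U' V' : lmodType k) (f : U -> U') (g : V -> V') :
  U ⊗ V -> U' ⊗ V' := tlift (fun u v => f u ⊗ g v).

Definition tswap (U V : lmodType k) : U ⊗ V -> V ⊗ U :=
  tlift (fun u v => v ⊗ u).

Definition tassoc (U V W : lmodType k) : U ⊗ (V ⊗ W) -> U ⊗ V ⊗ W :=
  tlift (fun u => tlift (fun v w => u ⊗ v ⊗ w)).

Lemma tlift_mult (A B C : algType k) (f : A -> B -> C) : bilin f ->
  (forall a b a' b', f (a * a') (b * b') = f a b * f a' b') ->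
  {morph tlift f : x y / x * y}.
Proof.
move=> fP fM.
have D x y : tlift f (x + y) = tlift f x + tlift f y.
  by have := tlift_linear fP 1 x y; rewrite !scale1r.
have Z : tlift f 0 = 0 by apply: (addrI (tlift f 0)); rewrite -D !addr0.
move=> x y; elim/tens_ind: x => [|a b|x x' IH IH'].
- by rewrite mul0r Z mul0r.
- elim/tens_ind: y => [|a' b'|y y' IH IH'].
  + by rewrite mulr0 Z mulr0.
  + by rewrite pureM !(tlift_pure fP) fM.
  + by rewrite mulrDr !D IH IH' mulrDr.
- by rewrite mulrDl !D IH IH' mulrDl.
Qed.

Lemma tmap_bilin (U V U' V' : lmodType k)
    (f : {linear U -> U'}) (g : {linear V -> V'}) :
  bilin (fun u v => f u ⊗ g v).
Proof.
by split=> [? a ? ?|? a ? ?] /=; rewrite linearP ?pureDl ?pureDr ?pureZl ?pureZr.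
Qed.

Lemma tswap_bilin (U V : lmodType k) : bilin (fun (u : U) (v : V) => v ⊗ u).
Proof. by split=> [? a ? ?|? a ? ?] /=; rewrite ?pureDl ?pureDr ?pureZl ?pureZr. Qed.

Lemma tassoc_bilin_inner (U V W : lmodType k) (u : U) :
  bilin (fun (v : V) (w : W) => u ⊗ v ⊗ w).
Proof.
by split=> [? a ? ?|? a ? ?] /=; rewrite ?pureDr ?pureZr ?pureDl ?pureZl.
Qed.

Lemma tassoc_bilin (U V W : lmodType k) :
  bilin (fun (u : U) => tlift (fun (v : V) (w : W) => u ⊗ v ⊗ w)).
Proof.
split=> [x a u u'|u a x y] /=; last first.
  exact: (tlift_linear (@tassoc_bilin_inner U V W u)).
rewrite -tlift_funD; apply: eq_tlift => v w.
by rewrite !(pureDl, pureZl).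
Qed.

Lemma tmap_pure (U V U' V' : lmodType k)
    (f : {linear U -> U'}) (g : {linear V -> V'}) u v :
  tmap f g (u ⊗ v) = f u ⊗ g v.
Proof. exact: (tlift_pure (tmap_bilin f g)). Qed.

Lemma tswap_pure (U V : lmodType k) (u : U) (v : V) : tswap (u ⊗ v) = v ⊗ u.
Proof. exact: (tlift_pure (@tswap_bilin U V)). Qed.

Lemma tassoc_pure (U V W : lmodType k) (u : U) (v : V) (w : W) :
  tassoc (u ⊗ (v ⊗ w)) = (u ⊗ v) ⊗ w.
Proof.
rewrite /tassoc (tlift_pure (@tassoc_bilin _ _ _)).
exact: (tlift_pure (@tassoc_bilin_inner U V W u)).
Qed.

Section Instances.
Variables (U V U' V' W : lmodType k) (f : {linear U -> U'}) (g : {linear V -> V'}).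
HB.instance Definition _ := GRing.isLinear.Build k (U ⊗ V)%type (U' ⊗ V')%type _
  (tmap f g) (tlift_linear (tmap_bilin f g)).
HB.instance Definition _ := GRing.isLinear.Build k (U ⊗ V)%type (V ⊗ U)%type _
  (@tswap U V) (tlift_linear (@tswap_bilin U V)).
HB.instance Definition _ :=
  GRing.isLinear.Build k (U ⊗ (V ⊗ W))%type (U ⊗ V ⊗ W)%type _
  (@tassoc U V W) (tlift_linear (@tassoc_bilin U V W)).
End Instances.

Section AlgInstances.
Variables (A B A' B' C : algType k).
Variables (f : {lrmorphism A -> A'}) (g : {lrmorphism B -> B'}).

Fact tmap_monoid_morphism : monoid_morphism (tmap f g).
Proof.
split; first by rewrite -pure1 tmap_pure !rmorph1 pure1.
apply: tlift_mult (tmap_bilin f g) _ => a b a' b'.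
by rewrite !rmorphM -pureM.
Qed.
HB.instance Definition _ :=
  GRing.isMonoidMorphism.Build (A ⊗ B)%type (A' ⊗ B')%type (tmap f g)
    tmap_monoid_morphism.

Fact tassoc_monoid_morphism : monoid_morphism (@tassoc A B C).
Proof.
split=> [|x y]; first by rewrite -!pure1 tassoc_pure.
elim/tens_ind: x => [|a s|x x' IH IH'].
- by rewrite mul0r linear0 mul0r.
- elim/tens_ind: y => [|a' t|y y' IH IH'].
  + by rewrite mulr0 linear0 mulr0.
  + rewrite pureM; elim/tens_ind: s => [|b c|s s' IH IH'].
    * by rewrite mul0r !pure0r linear0 mul0r.
    * elim/tens_ind: t => [|b' c'|t t' IH IH'].
      - by rewrite mulr0 !pure0r linear0 mulr0.
      - by rewrite pureM !tassoc_pure !pureM.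
      - by rewrite mulrDr !pureDr !linearD /= IH IH' mulrDr.
    * by rewrite mulrDl !pureDr !linearD /= IH IH' mulrDl.
  + by rewrite mulrDr !linearD /= IH IH' mulrDr.
- by rewrite mulrDl !linearD /= IH IH' mulrDl.
Qed.
HB.instance Definition _ :=
  GRing.isMonoidMorphism.Build (A ⊗ (B ⊗ C))%type (A ⊗ B ⊗ C)%type
    (@tassoc A B C) tassoc_monoid_morphism.
End AlgInstances.

End TensorMaps.

Record hopfAlgebra (k : fieldType) := HopfAlgebra {
  hopf_alg :> algType k;
  comul : {lrmorphism hopf_alg -> (hopf_alg ⊗ hopf_alg)%type};
  counit : {lrmorphism hopf_alg -> k^o};
  antipode : {linear hopf_alg -> hopf_alg};
  comulA : forall x, tmap comul idfun (comul x) = tassoc (tmap idfun comul (comul x));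
  counitl : forall x, tlift (fun y z => counit y *: z) (comul x) = x;
  counitr : forall x, tlift (fun y z => counit z *: y) (comul x) = x;
  antipodel : forall x, tlift (fun y z => antipode y * z) (comul x) = (counit x)%:A;
  antipoder : forall x, tlift (fun y z => y * antipode z) (comul x) = (counit x)%:A
}.

Section Quasitriangular.
Variables (k : fieldType) (H : hopfAlgebra k).

Definition leg12 (R : H ⊗ H) : H ⊗ H ⊗ H := tlift (fun r s => r ⊗ s ⊗ 1) R.
Definition leg13 (R : H ⊗ H) : H ⊗ H ⊗ H := tlift (fun r s => r ⊗ 1 ⊗ s) R.
Definition leg23 (R : H ⊗ H) : H ⊗ H ⊗ H := tlift (fun r s => 1 ⊗ r ⊗ s) R.

Record universal_R_matrix (R : H ⊗ H) : Prop := UniversalRMatrix {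
  Rmatrix_unit : exists R', R * R' = 1 /\ R' * R = 1;
  Rmatrix_comul : forall x, tswap (comul H x) * R = R * comul H x;
  Rmatrix_comull : tmap (comul H) idfun R = leg13 R * leg23 R;
  Rmatrix_comulr : tassoc (tmap idfun (comul H) R) = leg13 R * leg12 R
}.

Definition quasitriangular : Prop := exists R, universal_R_matrix R.

End Quasitriangular.

Inductive expr (k X : Type) : Type :=
| Gen of X
| Cst of k
| Add of expr k X & expr k X
| Opp of expr k X
| Mul of expr k X & expr k X.

Arguments Gen {k X}.
Arguments Cst {k X}.

HB.instance Definition _ (k X : Type) := gen_eqMixin (expr k X).
HB.instance Definition _ (k X : Type) := gen_choiceMixin (expr k X).

Declare Scope expr_scope.
Delimit Scope expr_scope with expr.
Bind Scope expr_scope with expr.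
Notation "e + f" := (Add e f) : expr_scope.
Notation "- e" := (Opp e) : expr_scope.
Notation "e - f" := (Add e (Opp f)) : expr_scope.
Notation "e * f" := (Mul e f) : expr_scope.
Notation "0" := (Cst 0%R) : expr_scope.
Notation "1" := (Cst 1%R) : expr_scope.

Section Presentation.
Variables (k : fieldType) (X : Type) (rel : expr k X -> expr k X -> Prop).
Local Notation expr := (expr k X).

(* [presented rel] is the algebra generated by [X] with relations [rel]: formal
   expressions in [X] modulo the least congruence that contains [rel] and the
   axioms of unital associative [k]-algebras. *)
Inductive pres_eq : expr -> expr -> Prop :=
| Peq_rel e f : rel e f -> pres_eq e f
| Peq_refl e : pres_eq e e
| Peq_sym e f : pres_eq e f -> pres_eq f e
| Peq_trans e f g : pres_eq e f -> pres_eq f g -> pres_eq e g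
| Peq_add e e' f f' : pres_eq e e' -> pres_eq f f' -> pres_eq (e + f) (e' + f')
| Peq_opp e e' : pres_eq e e' -> pres_eq (- e) (- e')
| Peq_mul e e' f f' : pres_eq e e' -> pres_eq f f' -> pres_eq (e * f) (e' * f')
| Peq_addA e f g : pres_eq (e + (f + g)) (e + f + g)
| Peq_addC e f : pres_eq (e + f) (f + e)
| Peq_add0 e : pres_eq (0 + e) e
| Peq_addN e : pres_eq (- e + e) 0
| Peq_mulA e f g : pres_eq (e * (f * g)) (e * f * g)
| Peq_mul1 e : pres_eq (1 * e) e
| Peq_mulr1 e : pres_eq (e * 1) e
| Peq_mulDl e f g : pres_eq ((e + f) * g) (e * g + f * g)
| Peq_mulDr e f g : pres_eq (e * (f + g)) (e * f + e * g)
| Peq_cstD a b : pres_eq (Cst (a + b)%R) (Cst a + Cst b)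
| Peq_cstM a b : pres_eq (Cst (a * b)%R) (Cst a * Cst b)
| Peq_cstC a e : pres_eq (Cst a * e) (e * Cst a).

Definition pres_rel e f := `[< pres_eq e f >].
Fact pres_rel_refl : reflexive pres_rel.
Proof. by move=> e; apply/asboolP; apply: Peq_refl. Qed.
Fact pres_rel_sym : symmetric pres_rel.
Proof. by move=> e f; apply/asboolP/asboolP; apply: Peq_sym. Qed.
Fact pres_rel_trans : transitive pres_rel.
Proof.
by move=> f e g /asboolP ef /asboolP fg; apply/asboolP; apply: Peq_trans fg.
Qed.
Canonical pres_equiv := EquivRel pres_rel pres_rel_refl pres_rel_sym pres_rel_trans.

Definition presented : Type := {eq_quot pres_rel}.
HB.instance Definition _ := Choice.copy presented {eq_quot pres_rel}.

Definition pres_class (e : expr) : presented := \pi_({eq_quot pres_rel}) e.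
Definition pres_repr (x : presented) : expr := repr (x : {eq_quot pres_rel}).

Lemma pres_reprK x : pres_class (pres_repr x) = x. Proof. exact: reprK. Qed.

Lemma pres_classP e f : pres_eq e f -> pres_class e = pres_class f.
Proof.
move=> ef; apply: (elimT (@eqmodP _ pres_equiv e f)); exact/asboolP.
Qed.

Lemma pres_repr_class e : pres_eq (pres_repr (pres_class e)) e.
Proof.
apply/asboolP; apply: (introT (@eqmodP _ pres_equiv _ e)); exact: reprK.
Qed.

Definition pres_add (x y : presented) := pres_class (pres_repr x + pres_repr y)%expr.
Definition pres_opp (x : presented) := pres_class (- pres_repr x)%expr.
Definition pres_mul (x y : presented) := pres_class (pres_repr x * pres_repr y)%expr.
Definition pres_scale (a : k) (x : presented) := pres_class (Cst a * pres_repr x)%expr.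

Lemma pres_addE e f : pres_add (pres_class e) (pres_class f) = pres_class (e + f)%expr.
Proof. by apply: pres_classP; apply: Peq_add; apply: pres_repr_class. Qed.
Lemma pres_oppE e : pres_opp (pres_class e) = pres_class (- e)%expr.
Proof. by apply: pres_classP; apply: Peq_opp; apply: pres_repr_class. Qed.
Lemma pres_mulE e f : pres_mul (pres_class e) (pres_class f) = pres_class (e * f)%expr.
Proof. by apply: pres_classP; apply: Peq_mul; apply: pres_repr_class. Qed.
Lemma pres_scale_class a e : pres_scale a (pres_class e) = pres_class (Cst a * e)%expr.
Proof.
apply: pres_classP; apply: Peq_mul; last exact: pres_repr_class.
exact: Peq_refl.
Qed.

Fact pres_addA : associative pres_add.
Proof.
move=> x y z; rewrite -(pres_reprK x) -(pres_reprK y) -(pres_reprK z) !pres_addE.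
exact/pres_classP/Peq_addA.
Qed.
Fact pres_addC : commutative pres_add.
Proof. by move=> x y; apply/pres_classP/Peq_addC. Qed.
Fact pres_add0 : left_id (pres_class 0) pres_add.
Proof. by move=> x; rewrite -(pres_reprK x) pres_addE; apply/pres_classP/Peq_add0. Qed.
Fact pres_addN : left_inverse (pres_class 0) pres_opp pres_add.
Proof. by move=> x; rewrite -(pres_reprK x) pres_oppE pres_addE; apply/pres_classP/Peq_addN. Qed.
HB.instance Definition _ :=
  GRing.isZmodule.Build presented pres_addA pres_addC pres_add0 pres_addN.

Fact pres_mulA : associative pres_mul.
Proof.
move=> x y z; rewrite -(pres_reprK x) -(pres_reprK y) -(pres_reprK z) !pres_mulE.
exact/pres_classP/Peq_mulA.
Qed.
Fact pres_mul1 : left_id (pres_class 1) pres_mul.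
Proof. by move=> x; rewrite -(pres_reprK x) pres_mulE; apply/pres_classP/Peq_mul1. Qed.
Fact pres_mulr1 : right_id (pres_class 1) pres_mul.
Proof. by move=> x; rewrite -(pres_reprK x) pres_mulE; apply/pres_classP/Peq_mulr1. Qed.
Fact pres_mulDl : left_distributive pres_mul pres_add.
Proof.
move=> x y z; rewrite -(pres_reprK x) -(pres_reprK y) -(pres_reprK z) !(pres_addE, pres_mulE).
exact/pres_classP/Peq_mulDl.
Qed.
Fact pres_mulDr : right_distributive pres_mul pres_add.
Proof.
move=> x y z; rewrite -(pres_reprK x) -(pres_reprK y) -(pres_reprK z) !(pres_addE, pres_mulE).
exact/pres_classP/Peq_mulDr.
Qed.
HB.instance Definition _ := GRing.Zmodule_isPzRing.Build presented
  pres_mulA pres_mul1 pres_mulr1 pres_mulDl pres_mulDr.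

Lemma pres_scaleE a (x : presented) : pres_scale a x = pres_class (Cst a) * x.
Proof. by rewrite -(pres_reprK x) pres_scale_class [RHS]pres_mulE. Qed.
Lemma pres_cstD a b : pres_class (Cst (a + b)) = pres_class (Cst a) + pres_class (Cst b).
Proof. by rewrite [RHS]pres_addE; apply/pres_classP/Peq_cstD. Qed.
Lemma pres_cstM a b : pres_class (Cst (a * b)) = pres_class (Cst a) * pres_class (Cst b).
Proof. by rewrite [RHS]pres_mulE; apply/pres_classP/Peq_cstM. Qed.

Fact pres_scaleA a b x : pres_scale a (pres_scale b x) = pres_scale (a * b) x.
Proof. by rewrite !pres_scaleE pres_cstM mulrA. Qed.
Fact pres_scale1 : left_id 1 pres_scale.
Proof. by move=> x; rewrite pres_scaleE mul1r. Qed.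
Fact pres_scaleDr : right_distributive pres_scale +%R.
Proof. by move=> a x y; rewrite !pres_scaleE mulrDr. Qed.
Fact pres_scaleDl x : {morph pres_scale^~ x : a b / a + b}.
Proof. by move=> a b; rewrite !pres_scaleE pres_cstD mulrDl. Qed.
HB.instance Definition _ := GRing.Zmodule_isLmodule.Build k presented
  pres_scaleA pres_scale1 pres_scaleDr pres_scaleDl.

Lemma pres_scalerE a (x : presented) : a *: x = pres_class (Cst a) * x.
Proof. exact: pres_scaleE. Qed.

Lemma pres_scaleAl a (x y : presented) : a *: (x * y) = (a *: x) * y.
Proof. by rewrite !pres_scalerE mulrA. Qed.
Lemma pres_scaleAr a (x y : presented) : a *: (x * y) = x * (a *: y).
Proof.
rewrite !pres_scalerE !mulrA; congr (_ * _).
by rewrite -(pres_reprK x) [LHS]pres_mulE [RHS]pres_mulE; apply/pres_classP/Peq_cstC.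
Qed.

Definition pres_gen (x : X) : presented := pres_class (Gen x).

Lemma pres_classD e f : pres_class (e + f) = pres_class e + pres_class f.
Proof. by rewrite [RHS]pres_addE. Qed.
Lemma pres_classM e f : pres_class (e * f) = pres_class e * pres_class f.
Proof. by rewrite [RHS]pres_mulE. Qed.
Lemma pres_classN e : pres_class (- e) = - pres_class e.
Proof. by rewrite [RHS]pres_oppE. Qed.
Lemma pres_classC a : pres_class (Cst a) = a *: (1 : presented).
Proof. by rewrite pres_scalerE mulr1. Qed.

Lemma pres_ind (P : presented -> Prop) :
  (forall x, P (pres_gen x)) -> (forall a, P (a *: (1 : presented))) ->
  (forall x y, P x -> P y -> P (x + y)) -> (forall x, P x -> P (- x)) ->
  (forall x y, P x -> P y -> P (x * y)) ->
  forall x, P x.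
Proof.
move=> Pg Pc PD PN PM x; rewrite -(pres_reprK x).
elim: (pres_repr x) => [y|a|e IHe f IHf|e IHe|e IHe f IHf].
- exact: Pg.
- by rewrite pres_classC.
- by rewrite pres_classD; apply: PD.
- by rewrite pres_classN; apply: PN.
- by rewrite pres_classM; apply: PM.
Qed.

Section Lift.
Variables (B : algType k) (g : X -> B).

Fixpoint eval (e : expr) : B :=
  match e with
  | Gen x => g x
  | Cst a => a%:A
  | Add e f => eval e + eval f
  | Opp e => - eval e
  | Mul e f => eval e * eval f
  end.

Definition pres_lift (x : presented) : B := eval (pres_repr x).

Hypothesis g_rel : forall e f, rel e f -> eval e = eval f.

Lemma eval_pres_eq e f : pres_eq e f -> eval e = eval f.
Proof.
elim=> {e f} /=.
- exact: g_rel.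
- by [].
- by move=> e f _ ->.
- by move=> e f h _ -> _ ->.
- by move=> e e' f f' _ -> _ ->.
- by move=> e e' _ ->.
- by move=> e e' f f' _ -> _ ->.
- by move=> *; rewrite addrA.
- by move=> *; rewrite addrC.
- by move=> *; rewrite scale0r add0r.
- by move=> *; rewrite scale0r addNr.
- by move=> *; rewrite mulrA.
- by move=> *; rewrite scale1r mul1r.
- by move=> *; rewrite scale1r mulr1.
- by move=> *; rewrite mulrDl.
- by move=> *; rewrite mulrDr.
- by move=> *; rewrite scalerDl.
- by move=> *; rewrite -scalerAl mul1r scalerA.
- by move=> *; rewrite -scalerAl mul1r -scalerAr mulr1.
Qed.

Lemma pres_lift_class e : pres_lift (pres_class e) = eval e.
Proof. exact: eval_pres_eq (pres_repr_class e). Qed.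

Lemma pres_lift_gen x : pres_lift (pres_gen x) = g x.
Proof. exact: pres_lift_class. Qed.

Lemma pres_lift_linear : linear pres_lift.
Proof.
move=> a x y; rewrite -(pres_reprK x) -(pres_reprK y) pres_scalerE.
by rewrite -pres_classM -pres_classD !pres_lift_class /= -scalerAl mul1r.
Qed.

Lemma pres_lift_monoid_morphism : monoid_morphism pres_lift.
Proof.
split; first by rewrite [LHS]pres_lift_class /= scale1r.
move=> x y; rewrite -(pres_reprK x) -(pres_reprK y) -pres_classM.
by rewrite !pres_lift_class.
Qed.

End Lift.
End Presentation.

Arguments pres_gen {k X rel}.
Arguments pres_class {k X rel}.

Section ConverseAlgebra.
Variables (k : fieldType) (A : algType k).
HB.instance Definition _ := GRing.Lmodule.on A^c.
Fact converse_scaleAl a (x y : A^c) : a *: (x * y) = (a *: x : A^c) * y.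
Proof. exact: (@scalerAr k A a y x). Qed.
HB.instance Definition _ := GRing.Lmodule_isLalgebra.Build k A^c converse_scaleAl.
Fact converse_scaleAr a (x y : A^c) : a *: (x * y) = x * (a *: y : A^c).
Proof. exact: (@scalerAl k A a y x). Qed.
HB.instance Definition _ := GRing.Lalgebra_isAlgebra.Build k A^c converse_scaleAr.
End ConverseAlgebra.

Definition pt1 : 'I_3 := @Ordinal 3 0 isT.
Definition pt2 : 'I_3 := @Ordinal 3 1 isT.
Definition pt3 : 'I_3 := @Ordinal 3 2 isT.

Inductive transposition := i12 | i13 | i23.

Definition tr (i : transposition) : 'S_3 :=
  match i with
  | i12 => tperm pt1 pt2
  | i13 => tperm pt1 pt3
  | i23 => tperm pt2 pt3
  end.

(* The product [ts] of permutations is the composite [x |-> t (s x)], whereas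
   in MathComp [(t * s)%g] is [x |-> s (t x)]. *)
Definition pcomp (t s : 'S_3) : 'S_3 := (s * t)%g.

Inductive A1_gen := GenH of 'S_3 | Gena of transposition.

Section A1.
Variable k : fieldType.

Local Notation H t := (Gen (GenH t)).
Local Notation a i := (Gen (Gena i)).

Inductive A1_rel : expr k A1_gen -> expr k A1_gen -> Prop :=
| A1_rel_H1 : A1_rel (H 1%g) 1
| A1_rel_HH t s : A1_rel (H t * H s) (H (pcomp t s))
| A1_rel_Ha t i j : tr j = pcomp (pcomp t (tr i)) t^-1%g ->
    A1_rel (H t * a i) (Cst ((-1) ^+ odd_perm t) * a j * H t)
| A1_rel_sq : A1_rel (a i12 * a i12) 0
| A1_rel_lin : A1_rel (a i12 * a i23 + a i23 * a i13 + a i13 * a i12)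
                      (1 - H (tr i12) * H (tr i23)).

Definition A1 : Type := presented A1_rel.

Definition Hg (t : 'S_3) : A1 := pres_gen (GenH t).
Definition ag (i : transposition) : A1 := pres_gen (Gena i).

HB.instance Definition _ := GRing.Lmodule.on A1.
HB.instance Definition _ := GRing.PzRing.on A1.

Definition counit_gen (x : A1_gen) : k^o :=
  match x with GenH _ => 1 | Gena _ => 0 end.

Fact counit_rel e f : A1_rel e f -> eval counit_gen e = eval counit_gen f.
Proof.
case=> [|t s|t i j _||] /=.
- by rewrite scale1r.
- by rewrite mulr1.
- by rewrite !mulr0 mul0r.
- by rewrite mulr0 scale0r.
- by rewrite !mulr0 !addr0 mulr1 scale1r subrr.
Qed.

Fact A1_1neq0 : (1 : A1) != 0.
Proof.
apply/eqP => /(congr1 (pres_lift counit_gen)).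
rewrite (pres_lift_monoid_morphism counit_rel).1.
have := pres_lift_linear counit_rel (-1) 0 0.
rewrite !scaleN1r !addNr => -> /eqP; by rewrite oner_eq0.
Qed.
HB.instance Definition _ := GRing.PzSemiRing_isNonZero.Build A1 A1_1neq0.
HB.instance Definition _ := GRing.Lmodule_isLalgebra.Build k A1
  (@pres_scaleAl k A1_gen A1_rel).
HB.instance Definition _ := GRing.Lalgebra_isAlgebra.Build k A1
  (@pres_scaleAr k A1_gen A1_rel).

Lemma A1_relE e f : A1_rel e f -> pres_class (rel := A1_rel) e = pres_class f.
Proof. by move=> ef; apply/pres_classP/Peq_rel. Qed.

Lemma A1_H1 : Hg 1%g = 1.
Proof. exact: A1_relE A1_rel_H1. Qed.

Lemma A1_HH t s : Hg t * Hg s = Hg (pcomp t s).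
Proof. by have := A1_relE (A1_rel_HH t s); rewrite pres_classM. Qed.

Lemma A1_Ha t i j : tr j = pcomp (pcomp t (tr i)) t^-1%g ->
  Hg t * ag i = (-1) ^+ odd_perm t *: (ag j * Hg t).
Proof.
move=> ji.
have E c (x y : presented A1_rel) : c *: (1 : presented A1_rel) * x * y = c *: (x * y).
  by rewrite -!pres_scaleAl mul1r.
by have := A1_relE (A1_rel_Ha ji); rewrite !pres_classM pres_classC E.
Qed.

Lemma A1_sq : ag i12 * ag i12 = 0.
Proof.
by have := A1_relE A1_rel_sq; rewrite pres_classM pres_classC scale0r.
Qed.

Lemma A1_lin : ag i12 * ag i23 + ag i23 * ag i13 + ag i13 * ag i12
  = 1 - Hg (tr i12) * Hg (tr i23).
Proof.
by have := A1_relE A1_rel_lin; rewrite !(pres_classD, pres_classN, pres_classM).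
Qed.

Lemma A1_ext (B : algType k) (f g : {lrmorphism A1 -> B}) :
  (forall t, f (Hg t) = g (Hg t)) -> (forall i, f (ag i) = g (ag i)) -> f =1 g.
Proof.
move=> fgH fga; elim/pres_ind => [[t|i]|a'|x y IHx IHy|x IHx|x y IHx IHy].
- exact: fgH.
- exact: fga.
- by rewrite !linearZ /= !rmorph1.
- by rewrite !linearD /= IHx IHy.
- by rewrite !linearN /= IHx.
- by rewrite !rmorphM /= IHx IHy.
Qed.

Definition A1_counit : A1 -> k^o := pres_lift counit_gen.
HB.instance Definition _ := GRing.isLinear.Build k A1 k^o _ A1_counit
  (pres_lift_linear counit_rel).
HB.instance Definition _ := GRing.isMonoidMorphism.Build A1 k^o A1_counit
  (pres_lift_monoid_morphism counit_rel).

Lemma A1_counit_H t : A1_counit (Hg t) = 1.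
Proof. exact: pres_lift_gen counit_rel (GenH t). Qed.
Lemma A1_counit_a i : A1_counit (ag i) = 0.
Proof. exact: pres_lift_gen counit_rel (Gena i). Qed.

Ltac tr_decide :=
  rewrite /pcomp /= ?tpermV; apply/permP => -[[|[|[|//]]] ?];
  rewrite !permM !permE; exact/val_inj.

Fact tr_cyc1 : pcomp (tr i23) (tr i13) = pcomp (tr i12) (tr i23).
Proof. tr_decide. Qed.
Fact tr_cyc2 : pcomp (tr i13) (tr i12) = pcomp (tr i12) (tr i23).
Proof. tr_decide. Qed.
Fact tr_conj1 : tr i13 = pcomp (pcomp (tr i12) (tr i23)) (tr i12)^-1.
Proof. tr_decide. Qed.
Fact tr_conj2 : tr i12 = pcomp (pcomp (tr i23) (tr i13)) (tr i23)^-1.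
Proof. tr_decide. Qed.
Fact tr_conj3 : tr i23 = pcomp (pcomp (tr i13) (tr i12)) (tr i13)^-1.
Proof. tr_decide. Qed.
Fact tr_conj4 : tr i23 = pcomp (pcomp (tr i12) (tr i13)) (tr i12)^-1.
Proof. tr_decide. Qed.
Fact tr_conj5 : tr i13 = pcomp (pcomp (tr i23) (tr i12)) (tr i23)^-1.
Proof. tr_decide. Qed.
Fact tr_conj6 : tr i12 = pcomp (pcomp (tr i13) (tr i23)) (tr i13)^-1.
Proof. tr_decide. Qed.
Fact tr_cyc3 : pcomp (tr i13) (tr i23) = pcomp (tr i23) (tr i12).
Proof. tr_decide. Qed.
Fact tr_cyc4 : pcomp (tr i12) (tr i13) = pcomp (tr i23) (tr i12).
Proof. tr_decide. Qed.
Fact tr_conj0 i : tr i = pcomp (pcomp (tr i) (tr i)) (tr i)^-1.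
Proof. by rewrite /pcomp mulKg. Qed.
Fact tr_odd i : odd_perm (tr i) = true.
Proof. by case: i; rewrite odd_tperm. Qed.
Fact tr_V i : (tr i)^-1%g = tr i.
Proof. by case: i; rewrite tpermV. Qed.
Fact tr_sq i : pcomp (tr i) (tr i) = 1%g.
Proof. by rewrite /pcomp -{1}tr_V mulVg. Qed.

Lemma A1_tr_a i j l : tr l = pcomp (pcomp (tr i) (tr j)) (tr i)^-1 ->
  Hg (tr i) * ag j = - (ag l * Hg (tr i)).
Proof. by move=> /A1_Ha ->; rewrite tr_odd expr1 scaleN1r. Qed.

Definition comul_gen (x : A1_gen) : A1 ⊗ A1 :=
  match x with
  | GenH t => Hg t ⊗ Hg t
  | Gena i => Hg (tr i) ⊗ ag i + ag i ⊗ 1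
  end.

Lemma cyc_cancel (V : zmodType) (x1 x2 x3 y1 y2 y3 p q r : V) :
  x1 - p + (q + y1) + (x2 - q + (r + y2)) + (x3 - r + (p + y3))
  = x1 + x2 + x3 + (y1 + y2 + y3).
Proof.
have E b c d e : b - c + (d + e) = b + e + (d - c) :> V.
  by rewrite addrACA [- c + e]addrC addrACA.
rewrite !E (addrACA (x1 + y1)) (addrACA _ _ (x3 + y3)).
have -> : q - p + (r - q) + (p - r) = 0.
  by rewrite (addrC (q - p)) (addrA (r - q)) subrK addrA subrK subrr.
by rewrite addr0 (addrACA x1) (addrACA (x1 + x2)).
Qed.

Fact comul_rel e f : A1_rel e f -> eval comul_gen e = eval comul_gen f.
Proof.
case=> [|t s|t i j tij||] /=.
- by rewrite A1_H1 scale1r.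
- by rewrite pureM A1_HH.
- rewrite mulrDr -!scalerAl mul1r mulrDl !pureM mulr1 mul1r.
  rewrite (A1_Ha tij) pureZl pureZr scalerDr !A1_HH; congr (_ *: (Hg _ ⊗ _) + _).
  by rewrite tij /pcomp mulKVg.
- rewrite mulrDl !mulrDr !pureM !mulr1 !mul1r A1_sq (A1_tr_a (tr_conj0 i12)).
  rewrite pure0r pure0l scale0r addr0 add0r -scaleN1r pureZl scaleN1r.
  exact: addNr.
- have DD i j : (Hg (tr i) ⊗ ag i + ag i ⊗ 1) * (Hg (tr j) ⊗ ag j + ag j ⊗ 1)
      = Hg (pcomp (tr i) (tr j)) ⊗ (ag i * ag j) + Hg (tr i) * ag j ⊗ ag i
        + (ag i * Hg (tr j) ⊗ ag j + ag i * ag j ⊗ 1).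
    by rewrite mulrDl !mulrDr !pureM !mulr1 !mul1r A1_HH.
  have pN (x y : A1) : (- x) ⊗ y = - (x ⊗ y) by rewrite -scaleN1r pureZl scaleN1r.
  rewrite !DD (A1_tr_a tr_conj1) (A1_tr_a tr_conj2) (A1_tr_a tr_conj3) tr_cyc1 tr_cyc2 !pN.
  set g := pcomp _ _; set u := ag i12 * _; set v := ag i23 * ag i13.
  set w := ag i13 * ag i12.
  set p := _ ⊗ ag i12; set q := _ ⊗ ag i23; set r := _ ⊗ ag i13.
  transitivity (Hg g ⊗ (u + v + w) + (u + v + w) ⊗ 1).
    by rewrite cyc_cancel !pureDr !pureDl.
  rewrite A1_lin A1_HH -/g pureDr pureDl -!scaleN1r pureZr pureZl pureM !A1_HH.
  by rewrite !scaleN1r pure1 scale1r addrC addrA subrK.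
Qed.

Definition A1_comul : A1 -> A1 ⊗ A1 := pres_lift comul_gen.
HB.instance Definition _ := GRing.isLinear.Build k A1 (A1 ⊗ A1)%type _ A1_comul
  (pres_lift_linear comul_rel).
HB.instance Definition _ := GRing.isMonoidMorphism.Build A1 (A1 ⊗ A1)%type
  A1_comul (pres_lift_monoid_morphism comul_rel).

Lemma A1_comul_H t : A1_comul (Hg t) = Hg t ⊗ Hg t.
Proof. exact: pres_lift_gen comul_rel (GenH t). Qed.
Lemma A1_comul_a i : A1_comul (ag i) = Hg (tr i) ⊗ ag i + ag i ⊗ 1.
Proof. exact: pres_lift_gen comul_rel (Gena i). Qed.

(* The antipode reverses products, hence the converse ring. *)
Definition antipode_gen (x : A1_gen) : A1^c :=
  match x with
  | GenH t => Hg t^-1%g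
  | Gena i => - (Hg (tr i) * ag i)
  end.

Fact antipode_rel e f : A1_rel e f -> eval antipode_gen e = eval antipode_gen f.
Proof.
have Z (c : k) (x : A1^c) : (c%:A : A1^c) * x = c *: x.
  by rewrite -scalerAl mul1r.
have M (x y : A1) : (x : A1^c) * (y : A1^c) = y * x :> A1 by [].
case=> [|t s|t i j tij||].
- by rewrite /= invg1 A1_H1 scale1r.
- by rewrite /= M A1_HH /pcomp invMg.
- rewrite /= Z -scalerAl !M mulNr mulrN scalerN; congr (- _).
  have -> : Hg t^-1 * (Hg (tr j) * ag j) = Hg (tr i) * (Hg t^-1 * ag j) :> A1.
    by rewrite !mulrA !A1_HH tij /pcomp !mulgA mulgK.
  have tji : tr i = pcomp (pcomp t^-1 (tr j)) t^-1^-1.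
    by rewrite tij /pcomp invgK !mulgA mulgV mul1g mulgK.
  rewrite (A1_Ha tji) odd_permV -scalerAr scalerA -expr2 sqrr_sign scale1r.
  by rewrite mulrA.
- rewrite /= M scale0r mulrNN mulrA (A1_tr_a (tr_conj0 i12)) !mulNr -!mulrA.
  by rewrite (mulrA (Hg _)) A1_HH tr_sq A1_H1 mul1r A1_sq oppr0.
- have E i j l : tr i = pcomp (pcomp (tr j) (tr l)) (tr j)^-1 ->
      (- (Hg (tr i) * ag i)) * (- (Hg (tr j) * ag j))
      = - (Hg (pcomp (tr i) (tr j)) * (ag l * ag j)).
    move=> /A1_tr_a ijl; rewrite mulrNN -mulrA (mulrA (ag i)).
    by rewrite -[ag i * _]opprK -ijl mulNr mulrN -A1_HH -!mulrA.
  rewrite /eval /antipode_gen !M scale1r !(tr_V, A1_HH).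
  rewrite (E _ _ _ tr_conj4) (E _ _ _ tr_conj5) (E _ _ _ tr_conj6).
  rewrite tr_cyc3 tr_cyc4.
  set g := Hg (pcomp (tr i23) (tr i12)).
  suff F : - (g * (ag i13 * ag i12)) - g * (ag i12 * ag i23)
           - g * (ag i23 * ag i13) = 1 - g by exact: F.
  rewrite -!opprD -!mulrDr -addrA addrC A1_lin A1_HH /g.
  rewrite mulrBr mulr1 A1_HH opprB; congr (_ - _).
  rewrite -A1_H1; congr Hg; rewrite /pcomp.
  by rewrite -{1}(tr_V i23) -{1}(tr_V i12) -invMg mulVg.
Qed.

Definition A1_antipode : A1 -> A1 := pres_lift antipode_gen.
Fact A1_antipode_linear : linear A1_antipode.
Proof. exact: (pres_lift_linear antipode_rel). Qed.
HB.instance Definition _ :=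
  GRing.isLinear.Build k A1 A1 _ A1_antipode A1_antipode_linear.

Lemma A1_antipode1 : A1_antipode 1 = 1.
Proof. exact: (pres_lift_monoid_morphism antipode_rel).1. Qed.
Lemma A1_antipodeM x y : A1_antipode (x * y) = A1_antipode y * A1_antipode x.
Proof. exact: ((pres_lift_monoid_morphism antipode_rel).2 x y). Qed.
Lemma A1_antipode_H t : A1_antipode (Hg t) = Hg t^-1%g.
Proof. exact: (pres_lift_gen antipode_rel (GenH t)). Qed.
Lemma A1_antipode_a i : A1_antipode (ag i) = - (Hg (tr i) * ag i).
Proof. exact: (pres_lift_gen antipode_rel (Gena i)). Qed.

Fact A1_comulA x :
  tmap A1_comul idfun (A1_comul x) = tassoc (tmap idfun A1_comul (A1_comul x)).
Proof.
pose f : {lrmorphism A1 -> (A1 ⊗ A1 ⊗ A1)%type} :=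
  (tmap A1_comul idfun \o A1_comul)%FUN.
pose g : {lrmorphism A1 -> (A1 ⊗ A1 ⊗ A1)%type} :=
  (@tassoc k A1 A1 A1 \o tmap idfun A1_comul \o A1_comul)%FUN.
apply: (@A1_ext _ f g) => [t|i]; rewrite /f /g /=.
  by rewrite A1_comul_H !tmap_pure /= A1_comul_H tassoc_pure.
rewrite A1_comul_a !linearD /= !tmap_pure /= A1_comul_H A1_comul_a rmorph1.
by rewrite -pure1 pureDl pureDr linearD /= !tassoc_pure addrA.
Qed.

Lemma counitl_bilin : bilin (fun y z : A1 => A1_counit y *: z).
Proof.
split=> [z c y y'|y c z z'] /=; last by rewrite scalerDr !scalerA mulrC.
by rewrite linearP /= scalerDl scalerA.
Qed.
Lemma counitr_bilin : bilin (fun y z : A1 => A1_counit z *: y).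
Proof.
split=> [z c y y'|y c z z'] /=; first by rewrite scalerDr !scalerA mulrC.
by rewrite linearP /= scalerDl scalerA.
Qed.
Lemma antil_bilin : bilin (fun y z : A1 => A1_antipode y * z).
Proof.
split=> [z c y y'|y c z z'] /=.
  by rewrite linearP mulrDl -scalerAl.
by rewrite mulrDr -scalerAr.
Qed.
Lemma antir_bilin : bilin (fun y z : A1 => y * A1_antipode z).
Proof.
split=> [z c y y'|y c z z'] /=.
  by rewrite mulrDl -scalerAl.
by rewrite linearP mulrDr -scalerAr.
Qed.

Lemma A1_tliftD (W : lmodType k) (f : A1 -> A1 -> W) : bilin f ->
  forall x y, tlift f (x + y) = tlift f x + tlift f y.
Proof. by move=> fP x y; have := tlift_linear fP 1 x y; rewrite !scale1r. Qed.
Lemma A1_tliftZ (W : lmodType k) (f : A1 -> A1 -> W) : bilin f ->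
  forall c x, tlift f (c *: x) = c *: tlift f x.
Proof.
move=> fP c x; have f0 : tlift f 0 = 0.
  by apply: (addrI (tlift f 0)); rewrite -A1_tliftD // !addr0.
by have := tlift_linear fP c x 0; rewrite f0 !addr0.
Qed.

Fact A1_counitl x : tlift (fun y z => A1_counit y *: z) (A1_comul x) = x.
Proof.
have fD := A1_tliftD counitl_bilin; have fZ := A1_tliftZ counitl_bilin.
have fp := tlift_pure counitl_bilin.
have fM : {morph tlift (fun y z : A1 => A1_counit y *: z) : u v / u * v}.
  apply: tlift_mult counitl_bilin _ => a1 b1 a2 b2.
  by rewrite rmorphM -scalerAl -scalerAr scalerA.
elim/pres_ind: x => [[t|i]|c|x y IHx IHy|x IHx|x y IHx IHy].
- by rewrite A1_comul_H fp A1_counit_H scale1r.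
- by rewrite A1_comul_a fD !fp A1_counit_H A1_counit_a scale1r scale0r addr0.
- by rewrite linearZ rmorph1 fZ -pure1 fp rmorph1 scale1r.
- by rewrite linearD fD IHx IHy.
- by rewrite -scaleN1r linearZ fZ IHx.
- by rewrite rmorphM fM IHx IHy.
Qed.

Fact A1_counitr x : tlift (fun y z => A1_counit z *: y) (A1_comul x) = x.
Proof.
have fD := A1_tliftD counitr_bilin; have fZ := A1_tliftZ counitr_bilin.
have fp := tlift_pure counitr_bilin.
have fM : {morph tlift (fun y z : A1 => A1_counit z *: y) : u v / u * v}.
  apply: tlift_mult counitr_bilin _ => a1 b1 a2 b2.
  by rewrite rmorphM -scalerAl -scalerAr scalerA.
elim/pres_ind: x => [[t|i]|c|x y IHx IHy|x IHx|x y IHx IHy].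
- by rewrite A1_comul_H fp A1_counit_H scale1r.
- by rewrite A1_comul_a fD !fp rmorph1 A1_counit_a scale1r scale0r add0r.
- by rewrite linearZ rmorph1 fZ -pure1 fp rmorph1 scale1r.
- by rewrite linearD fD IHx IHy.
- by rewrite -scaleN1r linearZ fZ IHx.
- by rewrite rmorphM fM IHx IHy.
Qed.

Lemma Hg_V t : Hg t^-1%g * Hg t = 1.
Proof. by rewrite A1_HH /pcomp mulgV A1_H1. Qed.
Lemma Hg_Vr t : Hg t * Hg t^-1%g = 1.
Proof. by rewrite A1_HH /pcomp mulVg A1_H1. Qed.

Fact A1_antipodel x :
  tlift (fun y z => A1_antipode y * z) (A1_comul x) = (A1_counit x)%:A.
Proof.
have fD := A1_tliftD antil_bilin; have fZ := A1_tliftZ antil_bilin.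
have fp := tlift_pure antil_bilin.
have fM (c : k) u v : tlift (fun y z : A1 => A1_antipode y * z) u = c%:A ->
    tlift (fun y z : A1 => A1_antipode y * z) (u * v)
    = c *: tlift (fun y z : A1 => A1_antipode y * z) v.
  move=> uc; elim/tens_ind: v => [|y z|v w IHv IHw].
  - by rewrite mulr0 -[0 in LHS](scale0r 0) fZ !scale0r -[0 in RHS](scale0r 0)
               fZ scale0r scaler0.
  - rewrite fp; have -> : c *: (A1_antipode y * z) = A1_antipode y * c%:A * z.
      by rewrite -scalerAr mulr1 -scalerAl.
    rewrite -uc; elim/tens_ind: u {uc} => [|a1 b1|u u' IHu IHu'].
    + by rewrite mul0r -[0](scale0r 0) fZ !scale0r mulr0 mul0r.
    + by rewrite pureM !fp A1_antipodeM !mulrA.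
    + by rewrite mulrDl !fD IHu IHu' mulrDr mulrDl.
  - by rewrite mulrDr !fD IHv IHw scalerDr.
elim/pres_ind: x => [[t|i]|c|x y IHx IHy|x IHx|x y IHx IHy].
- by rewrite A1_comul_H fp A1_counit_H A1_antipode_H Hg_V scale1r.
- rewrite A1_comul_a fD !fp A1_counit_a A1_antipode_H A1_antipode_a tr_V.
  by rewrite mulr1 subrr scale0r.
- rewrite !linearZ !rmorph1 fZ -pure1 fp A1_antipode1 mulr1 /=.
  by rewrite -[_ *: (1 : k^o)]/(_ * 1) mulr1.
- by rewrite !linearD fD IHx IHy scalerDl.
- by rewrite -scaleN1r !linearZ fZ IHx scalerA.
- by rewrite !rmorphM (fM _ _ _ IHx) IHy scalerA.
Qed.

Fact A1_antipoder x :
  tlift (fun y z => y * A1_antipode z) (A1_comul x) = (A1_counit x)%:A.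
Proof.
have fD := A1_tliftD antir_bilin; have fZ := A1_tliftZ antir_bilin.
have fp := tlift_pure antir_bilin.
have fM (c : k) u v : tlift (fun y z : A1 => y * A1_antipode z) v = c%:A ->
    tlift (fun y z : A1 => y * A1_antipode z) (u * v)
    = c *: tlift (fun y z : A1 => y * A1_antipode z) u.
  move=> vc; elim/tens_ind: u => [|y z|u w IHu IHw].
  - by rewrite mul0r -[0 in LHS](scale0r 0) fZ !scale0r -[0 in RHS](scale0r 0)
               fZ scale0r scaler0.
  - rewrite fp; have -> : c *: (y * A1_antipode z) = y * c%:A * A1_antipode z.
      by rewrite -scalerAr mulr1 -scalerAl.
    rewrite -vc; elim/tens_ind: v {vc} => [|a1 b1|v v' IHv IHv'].
    + by rewrite mulr0 -[0](scale0r 0) fZ !scale0r mulr0 mul0r.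
    + by rewrite pureM !fp A1_antipodeM !mulrA.
    + by rewrite mulrDr !fD IHv IHv' mulrDr mulrDl.
  - by rewrite mulrDl !fD IHu IHw scalerDr.
elim/pres_ind: x => [[t|i]|c|x y IHx IHy|x IHx|x y IHx IHy].
- by rewrite A1_comul_H fp A1_counit_H A1_antipode_H Hg_Vr scale1r.
- rewrite A1_comul_a fD !fp A1_counit_a A1_antipode1 A1_antipode_a.
  by rewrite mulrN mulrA A1_HH tr_sq A1_H1 mul1r mulr1 addNr scale0r.
- rewrite !linearZ !rmorph1 fZ -pure1 fp A1_antipode1 mulr1 /=.
  by rewrite -[_ *: (1 : k^o)]/(_ * 1) mulr1.
- by rewrite !linearD fD IHx IHy scalerDl.
- by rewrite -scaleN1r !linearZ fZ IHx scalerA.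
- by rewrite !rmorphM (fM _ _ _ IHy) IHx scalerA mulrC.
Qed.

Definition A1_hopf : hopfAlgebra k :=
  HopfAlgebra A1_comulA A1_counitl A1_counitr A1_antipodel A1_antipoder.

End A1.

(* Main.v *)
(* Evaluating [Δ^op(x) R = R Δ(x)] under [χ ⊗ π], for a character [χ] and a
   representation [π], makes [T = (χ ⊗ π)(R)] an isomorphism between the modules
   [χ ⊗ π] and [π ⊗ χ].  With [χ] the sign character, [T] commutes with every
   [π(H_t)] and anticommutes with every [π(a_i)].  The algebra has a
   two-dimensional module [π] extending the reflection representation of [S_3],
   with nonzero [π(a_i)], and such a [T] must then vanish. *)
From HB Require Import structures.
From mathcomp Require Import all_boot all_order all_algebra.
From mathcomp Require Import all_fingroup ring.
Require Import Defs.

Set Implicit Arguments.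
Unset Strict Implicit.
Unset Printing Implicit Defensive.

Import GRing.Theory.
Local Open Scope ring_scope.

(** * Intertwiners obtained from a universal R-matrix *)

Section CharacterTwist.
Variables (k : fieldType) (H : hopfAlgebra k) (B : algType k).
Variables (chi : {lrmorphism H -> k^o}) (pi : {lrmorphism H -> B}).

(** This is [chi ⊗ pi], with [k ⊗ B] identified with [B]. *)
Definition char_tensor : H ⊗ H -> B := tlift (fun x y => chi x *: pi y).

Lemma char_tensor_bilin : bilin (fun x y : H => chi x *: pi y).
Proof.
split=> [y c x x'|x c y y'] /=; rewrite linearP.
  by rewrite scalerDl -scalerA.
by rewrite scalerDr !scalerA mulrC.
Qed.

Lemma char_tensor_pure x y : char_tensor (x ⊗ y) = chi x *: pi y.
Proof. exact: (tlift_pure char_tensor_bilin). Qed.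

Lemma char_tensorD u v : char_tensor (u + v) = char_tensor u + char_tensor v.
Proof. by have := tlift_linear char_tensor_bilin 1 u v; rewrite !scale1r. Qed.

(** The values of [chi] are scalars, hence central in [B]. *)
Lemma char_tensorM : {morph char_tensor : u v / u * v}.
Proof.
apply: tlift_mult char_tensor_bilin _ => x y x' y'.
by rewrite !rmorphM -scalerAr -scalerAl scalerA mulrC.
Qed.

Lemma quasitriangular_char_twist : quasitriangular H ->
  exists T T' : B, T * T' = 1 /\
    forall x, char_tensor (tswap (comul H x)) * T = T * char_tensor (comul H x).
Proof.
case=> R [[R' [RR' _]] RD _ _]; exists (char_tensor R), (char_tensor R'); split.
  by rewrite -char_tensorM RR' -pure1 char_tensor_pure !rmorph1 scale1r.
by move=> x; rewrite -!char_tensorM RD.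
Qed.

End CharacterTwist.

(** * The sign character of the algebra *)

Section SignCharacter.
Variable k : fieldType.

Definition sgn_gen (x : A1_gen) : k^o :=
  match x with GenH t => (-1) ^+ odd_perm t | Gena _ => 0 end.

(** Sending every [a_i] to 0 respects the inhomogeneous relation because [H_12 H_23] is even, so its
    image is 1. *)
Fact sgn_rel e f : A1_rel (k := k) e f -> eval sgn_gen e = eval sgn_gen f.
Proof.
case=> [|t s|t i j _||] /=.
- by rewrite odd_perm1 scale1r.
- by rewrite /pcomp odd_permM signr_addb mulrC.
- by rewrite !mulr0 mul0r.
- by rewrite mulr0 scale0r.
- by rewrite !odd_tperm /= !mulr0 !addr0 mulrNN mulr1 scale1r subrr.
Qed.

Definition A1_sgn : A1 k -> k^o := pres_lift sgn_gen.
HB.instance Definition _ := GRing.isLinear.Build k (A1 k) k^o _ A1_sgn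
  (pres_lift_linear sgn_rel).
HB.instance Definition _ := GRing.isMonoidMorphism.Build (A1 k) k^o A1_sgn
  (pres_lift_monoid_morphism sgn_rel).

Lemma A1_sgn_H t : A1_sgn (Hg k t) = (-1) ^+ odd_perm t.
Proof. exact: pres_lift_gen sgn_rel (GenH t). Qed.
Lemma A1_sgn_a i : A1_sgn (ag k i) = 0.
Proof. exact: pres_lift_gen sgn_rel (Gena i). Qed.

End SignCharacter.

(** * Explicit 2 by 2 matrices, reducing matrix identities to scalar ones *)

Section Matrix2.
Variable R : comNzRingType.

Definition mx2 (a b c d : R) : 'M[R]_2 :=
  \matrix_(i, j) if i == 0 then (if j == 0 then a else b)
                 else if j == 0 then c else d.

Lemma mx2_eta (M : 'M[R]_2) : M = mx2 (M 0 0) (M 0 1) (M 1 0) (M 1 1).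
Proof.
by apply/matrixP=> -[[|[|//]] i2] -[[|[|//]] j2]; rewrite !mxE /=;
   congr (M _ _); apply: val_inj.
Qed.

Lemma mx2_inj a b c d a' b' c' d' : mx2 a b c d = mx2 a' b' c' d' ->
  [/\ a = a', b = b', c = c' & d = d'].
Proof.
by move/matrixP=> E; split; [have := E 0 0|have := E 0 1|have := E 1 0|have := E 1 1];
  rewrite !mxE.
Qed.

Lemma mx2D a b c d a' b' c' d' :
  mx2 a b c d + mx2 a' b' c' d' = mx2 (a + a') (b + b') (c + c') (d + d').
Proof. by apply/matrixP=> i j; rewrite !mxE; case: ifP; case: ifP. Qed.

Lemma mx2N a b c d : - mx2 a b c d = mx2 (- a) (- b) (- c) (- d).
Proof. by apply/matrixP=> i j; rewrite !mxE; case: ifP; case: ifP. Qed.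

Lemma mx2Z e a b c d : e *: mx2 a b c d = mx2 (e * a) (e * b) (e * c) (e * d).
Proof. by apply/matrixP=> i j; rewrite !mxE; case: ifP; case: ifP. Qed.

Lemma mx2M a b c d a' b' c' d' : mx2 a b c d * mx2 a' b' c' d' =
  mx2 (a * a' + b * c') (a * b' + b * d') (c * a' + d * c') (c * b' + d * d').
Proof.
apply/matrixP=> i j; rewrite !mxE !big_ord_recl big_ord0 !mxE /= addr0.
by case: ifP; case: ifP.
Qed.

Lemma mx2_1 : 1 = mx2 1 0 0 1.
Proof. by apply/matrixP=> -[[|[|//]] ?] -[[|[|//]] ?]; rewrite !mxE. Qed.

Lemma mx2_0 : 0 = mx2 0 0 0 0.
Proof. by apply/matrixP=> i j; rewrite !mxE; case: ifP; case: ifP. Qed.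

Definition mx2E := (mx2D, mx2N, mx2Z, mx2M).

End Matrix2.

(** Induction on the length of a word, since the transpositions generate [S_3]. *)
Lemma tr_ind (P : 'S_3 -> Prop) :
  P 1%g -> (forall i t, P t -> P (tr i * t)%g) -> forall t, P t.
Proof.
move=> P1 PM t; have [ts -> ] := prod_tpermP t.
elim: ts => [|[x y] ts IH] /=; first by rewrite big_nil.
rewrite big_cons /= => /andP[xy /IH{}IH].
have [i ->] : exists i, tperm x y = tr i.
  have I3 (z : 'I_3) : [\/ z = pt1, z = pt2 | z = pt3].
    by case: z => -[|[|[|//]]] ?; constructor; apply: val_inj.
  move: xy; rewrite /dpair /=.
  by case: (I3 x) => ->; case: (I3 y) => -> // _;
    first [by exists i12 | by exists i13 | by exists i23
          |by exists i12; rewrite tpermC | by exists i13; rewrite tpermC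
          |by exists i23; rewrite tpermC].
exact: PM.
Qed.

(** * The reflection representation of [S_3] *)

Section ReflectionRep.
Variable k : fieldType.

(* The columns of [simple_roots] are [e1 - e2] and [e2 - e3], and [root_coord]
   reads off the coordinates of a sum-zero vector in this basis. *)
Definition simple_roots : 'M[k]_(3, 2) :=
  \matrix_(i, j) ((i == j :> nat)%:R - (i == j.+1 :> nat)%:R).
Definition root_coord : 'M[k]_(2, 3) :=
  \matrix_(i, j) (if i == 0 then (j == 0)%:R else - (j == pt3)%:R).

(** The transpose of [perm_mx t] sends [e_j] to [e_(t j)]; it turns the product order of MathComp
    into that of [pcomp]. *)
Definition refl_rep (t : 'S_3) : 'M[k]_2 :=
  root_coord *m (perm_mx t)^T *m simple_roots.

(** A permutation matrix fixes the row of ones, and each simple root has coordinate sum zero. *)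
Lemma sum_zero_perm (t : 'S_3) :
  const_mx 1 *m (perm_mx t)^T *m simple_roots = 0 :> 'rV[k]_2.
Proof.
have -> : const_mx 1 *m (perm_mx t)^T = const_mx 1 :> 'rV[k]_3.
  by rewrite tr_perm_mx -col_permE; apply/rowP=> j; rewrite !mxE.
apply/rowP=> -[[|[|//]] ?]; rewrite !mxE !big_ord_recl big_ord0 !mxE /=; ring.
Qed.

Lemma root_coordK (v : 'M[k]_(3, 2)) :
  const_mx 1 *m v = 0 :> 'rV[k]_2 -> simple_roots *m root_coord *m v = v.
Proof.
move=> /rowP v0; apply/matrixP=> i j; have := v0 j.
rewrite !mxE !big_ord_recl big_ord0 !mxE !mul1r addr0 => vj.
have v2 : v (lift ord0 ord0) j = - (v ord0 j + v (lift ord0 (lift ord0 ord0)) j).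
  by rewrite -[LHS]subr0 -vj; ring.
case: i => -[|[|[|//]]] i3; rewrite ?mxE ?(big_ord_recl, big_ord0, mxE) /=.
- by rewrite (_ : Ordinal i3 = ord0); [ring|apply: val_inj].
- by rewrite (_ : Ordinal i3 = lift ord0 ord0); [rewrite v2; ring|apply: val_inj].
by rewrite (_ : Ordinal i3 = lift ord0 (lift ord0 ord0)); [ring|apply: val_inj].
Qed.

(** The inner factor [simple_roots *m root_coord] acts as the identity on permuted roots, whose
    coordinates sum to zero. *)
Lemma refl_repM t s : refl_rep t * refl_rep s = refl_rep (pcomp t s).
Proof.
rewrite /refl_rep /pcomp -[LHS]/(_ *m _) -!mulmxA (mulmxA simple_roots).
rewrite root_coordK ?mulmxA ?sum_zero_perm // perm_mxM trmx_mul.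
by rewrite !mulmxA.
Qed.

Lemma refl_repE t : refl_rep t =
  mx2 ((t pt1 == pt1)%:R - (t pt2 == pt1)%:R) ((t pt2 == pt1)%:R - (t pt3 == pt1)%:R)
      ((t pt2 == pt3)%:R - (t pt1 == pt3)%:R) ((t pt3 == pt3)%:R - (t pt2 == pt3)%:R).
Proof.
have e0 : ord0 = pt1 by apply: val_inj.
have e1 : lift ord0 ord0 = pt2 :> 'I_3 by apply: val_inj.
have e2 : lift ord0 (lift ord0 ord0) = pt3 :> 'I_3 by apply: val_inj.
apply/matrixP=> -[[|[|//]] i2] -[[|[|//]] j2];
 rewrite !mxE !big_ord_recl big_ord0 !mxE !big_ord_recl !big_ord0 !mxE /=
   ?e1 ?e2 ?e0 /=; ring.
Qed.

Lemma refl_rep1 : refl_rep 1%g = 1.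
Proof. by rewrite refl_repE mx2_1 !perm1 /=; congr mx2; ring. Qed.

Lemma refl_rep_tr i : refl_rep (tr i) =
  match i with
  | i12 => mx2 (-1) 1 0 1
  | i13 => mx2 0 (-1) (-1) 0
  | i23 => mx2 1 0 1 (-1)
  end.
Proof.
case: i; rewrite refl_repE !(tpermL, tpermR);
 rewrite ?(@tpermD _ pt1 pt2 pt3) ?(@tpermD _ pt1 pt3 pt2) ?(@tpermD _ pt2 pt3 pt1) //=;
 by congr mx2; ring.
Qed.

(* [ρ - ρ^-1] for the rotation [ρ = H_12 H_23]. *)
Definition refl_turn : 'M[k]_2 := mx2 1 (-2%:R) 2%:R (-1).

(** Conjugation by a reflection inverts the rotation [ρ], so it negates [ρ - ρ^-1]; each
    transposition in a word for [t] contributes one sign. *)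
Lemma refl_rep_turn t :
  refl_rep t * refl_turn = (-1) ^+ odd_perm t *: (refl_turn * refl_rep t).
Proof.
elim/tr_ind: t => [|i t IH].
  by rewrite odd_perm1 scale1r refl_rep1 mul1r mulr1.
rewrite -[(_ * _)%g]/(pcomp t (tr i)) -refl_repM /pcomp odd_permM tr_odd.
have E : refl_rep (tr i) * refl_turn = - (refl_turn * refl_rep (tr i)).
  rewrite refl_rep_tr /refl_turn; case: i; rewrite !mx2E; congr mx2; ring.
rewrite -mulrA E mulrN [in LHS]mulrA IH -scalerAl -mulrA.
by rewrite -scaleN1r scalerA signr_addb.
Qed.

(** * Extension of the representation to the generators [a_i] *)

Section Scalar.
Variable e : k.
Hypothesis e2 : 9%:R * (e * e) = -1.

(* Since [J = refl_turn] anticommutes with [H_i], and [H_i^2 = 1], the square of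
   [(1 - H_i) J] vanishes; the constant [e] is fixed by the last relation of
   [A1_rel]. *)
Definition refl_gen (x : A1_gen) : 'M[k]_2 :=
  match x with
  | GenH t => refl_rep t
  | Gena i => e *: ((1 - refl_rep (tr i)) * refl_turn)
  end.

Lemma refl_gen_a i : refl_gen (Gena i) =
  match i with
  | i12 => mx2 0 (- (3%:R * e)) 0 0
  | i13 => mx2 (3%:R * e) (- (3%:R * e)) (3%:R * e) (- (3%:R * e))
  | i23 => mx2 0 0 (3%:R * e) 0
  end.
Proof.
rewrite /= refl_rep_tr /refl_turn mx2_1.
by case: i; rewrite !mx2E; congr mx2; ring.
Qed.

Fact refl_rel x y : A1_rel x y -> eval refl_gen x = eval refl_gen y.
Proof.
case=> [|t s|t i j tij||].
- by rewrite /= refl_rep1 scale1r.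
- by rewrite /= refl_repM.
(* Conjugation by [H_t] only permutes the factors [1 - H_i]; the sign comes from moving [H_t] past
   [refl_turn]. *)
- have comm : refl_rep t * (1 - refl_rep (tr i)) = (1 - refl_rep (tr j)) * refl_rep t.
    rewrite mulrBr mulrBl mulr1 mul1r !refl_repM.
    by congr (_ - refl_rep _); rewrite tij /pcomp mulKVg.
  rewrite /= -scalerAr -!scalerAl mul1r -!scalerAl mulrA comm -!mulrA.
  by rewrite refl_rep_turn -scalerAr !scalerA mulrC.
- rewrite -[LHS]/(refl_gen (Gena i12) * refl_gen (Gena i12)) -[RHS]/(0 *: 1).
  by rewrite refl_gen_a scale0r mx2M mx2_0; congr mx2; ring.
- pose a i := refl_gen (Gena i).
  suff : a i12 * a i23 + a i23 * a i13 + a i13 * a i12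
         = 1 *: 1 - refl_rep (tr i12) * refl_rep (tr i23) by [].
  rewrite /a !refl_gen_a !refl_rep_tr scale1r mx2_1 !mx2E.
  (* The left-hand entries are integer multiples of [(3e)^2], so this value matches them with the
     integer entries of [1 - H_12 H_23]. *)
  have e9 : 3%:R * e * (3%:R * e) = -1 by rewrite -e2; ring.
  congr mx2; rewrite ?(mulrN, mulNr) ?e9; ring.
Qed.

Definition A1_refl : {lrmorphism A1 k -> 'M[k]_2} :=
  HB.pack (pres_lift refl_gen : A1 k -> 'M[k]_2)
    (GRing.isLinear.Build k (A1 k) 'M[k]_2 *:%R (pres_lift refl_gen : A1 k -> 'M[k]_2)
       (pres_lift_linear refl_rel))
    (GRing.isMonoidMorphism.Build (A1 k) 'M[k]_2 (pres_lift refl_gen : A1 k -> 'M[k]_2)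
       (pres_lift_monoid_morphism refl_rel)).

Lemma A1_refl_H t : A1_refl (Hg k t) = refl_rep t.
Proof. exact: pres_lift_gen refl_rel (GenH t). Qed.
Lemma A1_refl_a i : A1_refl (ag k i) = refl_gen (Gena i).
Proof. exact: pres_lift_gen refl_rel (Gena i). Qed.

(** Anticommuting with [a_12], a multiple of the matrix unit [E_12], forces [c = 0] and [d = -a];
    [a_23], a multiple of [E_21], forces [b = 0]. Commuting with [H_12] then leaves [2a = 0]. *)
Lemma refl_sgn_twist_trivial (T : 'M[k]_2) : 2%:R != 0 :> k ->
  (forall t, refl_rep t * T = T * refl_rep t) ->
  (forall i, refl_gen (Gena i) * T = - (T * refl_gen (Gena i))) -> T = 0.
Proof.
move=> two0 TH Ta.
(* The square of [3e] is -1, so [3e] can be cancelled. *)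
have e30 : 3%:R * e != 0.
  apply/eqP => e0; have := oner_neq0 k; rewrite -[1]opprK -e2.
  have -> : 9%:R * (e * e) = 3%:R * e * (3%:R * e) by ring.
  by rewrite e0 mul0r oppr0 eqxx.
have e3K x : 3%:R * e * x = 0 -> x = 0.
  by move/eqP; rewrite mulf_eq0 (negPf e30) => /eqP.
have := TH (tr i12); have := Ta i23; have := Ta i12.
rewrite !refl_gen_a refl_rep_tr (mx2_eta T) !mx2E mx2_0.
set a := T 0 0; set b := T 0 1; set c := T 1 0; set d := T 1 1.
move=> /mx2_inj[Ec Ead _ _] /mx2_inj[Eb _ _ _] /mx2_inj[_ E _ _].
have c0 : c = 0.
  by apply: e3K; transitivity (- (0 * a + - (3%:R * e) * c)); [ring|rewrite Ec; ring].
have b0 : b = 0.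
  by apply: e3K; transitivity (- - (a * 0 + b * (3%:R * e))); [ring|rewrite -Eb; ring].
have da : d = - a.
  apply/eqP; rewrite -subr_eq0; apply/eqP/e3K.
  transitivity (- (0 * b + - (3%:R * e) * d) + 3%:R * e * a); first ring.
  by rewrite Ead; ring.
have a0 : a = 0.
  (* The upper right entry for [H_12] reads [d - b = a + b], which becomes [-a = a]. *)
  apply/eqP; move: E; rewrite b0 da => /eqP; rewrite -subr_eq0.
  rewrite (_ : _ - _ = - (2%:R * a)); last ring.
  by rewrite oppr_eq0 mulf_eq0 (negPf two0).
by rewrite da b0 c0 a0 oppr0.
Qed.

End Scalar.
End ReflectionRep.

(** * The contradiction in characteristic zero *)

Theorem corollary5p13 (k : closedFieldType)
    (char0 : [pchar k]%R =i pred0) :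
  ~ quasitriangular (A1_hopf k).
Proof.
have natr0 n : (n.+1)%:R != 0 :> k by rewrite (pcharf0P k).1.
have [e e2] : exists e : k, 9%:R * (e * e) = -1.
  (* The scalar [e] is a root of [X^2 + 1/9]. *)
  have [|e ee] := @solve_monicpoly k 2 (fun i => if i is 0 then - 9%:R^-1 else 0).
    by [].
  exists e; move: ee; rewrite !big_ord_recl big_ord0 /= => ee.
  rewrite -expr2 ee mul0r !addr0 mulr1 mulrN mulfV //; exact: natr0.
pose chi : {lrmorphism A1_hopf k -> k^o} := @A1_sgn k.
pose pi : {lrmorphism A1_hopf k -> 'M[k]_2} := A1_refl e2.
move=> /(@quasitriangular_char_twist _ _ _ chi pi)[T [T' [TT' TP]]].
have chiH t : chi (Hg k t) = (-1) ^+ odd_perm t := A1_sgn_H k t.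
have chia i : chi (ag k i) = 0 := A1_sgn_a k i.
have piH t : pi (Hg k t) = refl_rep k t := A1_refl_H e2 t.
have pia i : pi (ag k i) = refl_gen e (Gena i) := A1_refl_a e2 i.
have comulH t : comul (A1_hopf k) (Hg k t) = Hg k t ⊗ Hg k t := A1_comul_H k t.
have comula i : comul (A1_hopf k) (ag k i) = Hg k (tr i) ⊗ ag k i + ag k i ⊗ 1 :=
  A1_comul_a k i.
have T0 : T = 0.
  apply: (refl_sgn_twist_trivial e2) => [|t|i]; first exact: natr0.
    (* The same sign [chi(H_t)] appears on both sides and cancels. *)
    have := TP (Hg k t); rewrite comulH tswap_pure char_tensor_pure chiH piH.
    by rewrite -scalerAl -scalerAr => /scalerI; apply; rewrite signr_eq0.
  (* Since [chi] kills [a_i], the swapped coproduct [a_i ⊗ H_i + 1 ⊗ a_i] maps to [pi(a_i)], while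
     the coproduct itself maps to [chi(H_i) pi(a_i) = - pi(a_i)]. *)
  have := TP (ag k i); rewrite comula linearD /= !tswap_pure !char_tensorD.
  rewrite !char_tensor_pure chiH chia pia rmorph1 tr_odd !scale0r scale1r.
  by rewrite add0r addr0 scaleN1r mulrN.
by have := oner_neq0 'M[k]_2; rewrite -TT' T0 mul0r eqxx.
Qed.
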